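(* Let $n\ge 0$ be an integer and let $X$ be a finite subquandle of the spherical quandle $S^n_{\mathbb{R}}$. If $\#X$ is even, then $X$ is a root system in $\mathbb{R}^{n+1}$; if $\#X$ is odd, then $X$ is isomorphic, as a quandle, to the dihedral quandle $R_{\#X}$.
   Context: $\#S$ denotes the cardinality of a set $S$. A quandle is a nonempty set $X$ with a binary operation $\triangleright$ such that (Q1) $x\triangleright x=x$ for all $x$; (Q2) for each $y\in X$ the map $s_y:X\to X$, $x\mapsto x\triangleright y$, is bijective; (Q3) $(x\triangleright y)\triangleright z=(x\triangleright z)\triangleright(y\triangleright z)$ for all $x,y,z$. A quandle homomorphism is a map $f$ with $f(x\triangleright y)=f(x)\triangleright f(y)$; a quandle isomorphism is a bijective quandle homomorphism. A subquandle of a quandle is a subset on which the operation induces a quandle structure (in particular it is nonempty). The spherical quandle $S^n_{\mathbb{R}}$ is the unit sphere $S^n\subset\mathbb{R}^{n+1}$ with operation $x\triangleright y:=2\langle x,y\rangle y-x$, where $\langle-,-\rangle$ is the Euclidean inner product. For an integer $m\ge 1$, the dihedral quandle $R_m$ is $\mathbb{Z}/m\mathbb{Z}$ with operation $x\triangleright y:=2y-x$. For $\alpha\in\mathbb{R}^{d}\setminus\{0\}$ let $\sigma_\alpha(v):=v-\frac{2\langle v,\alpha\rangle}{\langle\alpha,\alpha\rangle}\alpha$ for $v\in\mathbb{R}^d$. A root system in $\mathbb{R}^d$ is a finite subset $X\subset\mathbb{R}^d\setminus\{0\}$ such that for every $\alpha\in X$: (1) $\mathbb{R}\alpha\cap X=\{\pm\alpha\}$;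 (2) $\sigma_\alpha(X)=X$. (No crystallographic or spanning condition is required.) *)

(* Defs.v *)
From mathcomp Require Import all_boot all_order all_algebra.
From mathcomp Require Import all_classical all_reals.
From mathcomp Require Import ring.
Import Order.TTheory GRing.Theory Num.Theory.

Set Implicit Arguments.
Unset Strict Implicit.
Unset Printing Implicit Defensive.

Local Open Scope classical_set_scope.
Local Open Scope ring_scope.

Record quandle_axioms (T : Type) (op : T -> T -> T) : Prop := QuandleAxioms {
  quandle_nonempty : exists x : T, True;
  quandle_idem : forall x, op x x = x;
  quandle_bij : forall y, bijective (fun x => op x y);
  quandle_dist : forall x y z, op (op x y) z = op (op x z) (op y z) }.

Record quandle := Quandle {
  quandle_sort :> Type;
  qop : quandle_sort -> quandle_sort -> quandle_sort;
  qopP : quandle_axioms qop }.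

Definition quandle_hom (Q1 Q2 : quandle) (f : Q1 -> Q2) : Prop :=
  forall x y, f (qop x y) = qop (f x) (f y).

Definition quandle_isomorphic (Q1 Q2 : quandle) : Prop :=
  exists f : Q1 -> Q2, quandle_hom f /\ bijective f.

Section Subquandle.
Variable Q : quandle.

Definition qop_closed (A : set Q) : Prop :=
  forall x y, x \in A -> y \in A -> qop x y \in A.

Definition sub_qop (A : set Q) (clA : qop_closed A) (x y : A) : A :=
  exist _ (qop (sval x) (sval y)) (clA _ _ (svalP x) (svalP y)).

Record subquandle := Subquandle {
  subquandle_set :> set Q;
  subquandle_closed : qop_closed subquandle_set;
  sub_qopP : quandle_axioms (sub_qop subquandle_closed) }.

Definition quandle_of_sub (X : subquandle) : quandle := Quandle (sub_qopP X).

End Subquandle.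

Definition dot (R : realType) (d : nat) (u v : 'rV[R]_d) : R :=
  \sum_i u 0 i * v 0 i.

Section DotTheory.
Variables (R : realType) (d : nat).
Implicit Types u v w : 'rV[R]_d.

Lemma dotC u v : dot u v = dot v u.
Proof. by apply: eq_bigr => i _; rewrite mulrC. Qed.

Lemma dotDl u v w : dot (u + v) w = dot u w + dot v w.
Proof. by rewrite -big_split; apply: eq_bigr => i _; rewrite mxE mulrDl. Qed.

Lemma dotZl c u w : dot (c *: u) w = c * dot u w.
Proof. by rewrite mulr_sumr; apply: eq_bigr => i _; rewrite mxE mulrA. Qed.

Lemma dotNl u w : dot (- u) w = - dot u w.
Proof. by rewrite -scaleN1r dotZl mulN1r. Qed.

Lemma dotBl u v w : dot (u - v) w = dot u w - dot v w.
Proof. by rewrite dotDl dotNl. Qed.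

Lemma dotZr c u w : dot w (c *: u) = c * dot w u.
Proof. by rewrite dotC dotZl dotC. Qed.

Lemma dotBr u v w : dot w (u - v) = dot w u - dot w v.
Proof. by rewrite dotC dotBl !(dotC w). Qed.

End DotTheory.

Section SphericalQuandle.
Variables (R : realType) (n : nat).

Definition sphere : Type := {x : 'rV[R]_n.+1 | dot x x == 1}.

Definition vec_op (x y : 'rV[R]_n.+1) : 'rV[R]_n.+1 :=
  (2 * dot x y) *: y - x.

Lemma dot_vec_op (x y z : 'rV[R]_n.+1) : dot z z = 1 ->
  dot (vec_op x z) (vec_op y z) = dot x y.
Proof.
move=> z1; rewrite /vec_op !(dotBl, dotBr, dotZl, dotZr) z1 (dotC z y).
ring.
Qed.

Lemma vec_op_sphere (x y : sphere) :
  dot (vec_op (sval x) (sval y)) (vec_op (sval x) (sval y)) == 1.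
Proof. by rewrite dot_vec_op ?(eqP (svalP y)) // (svalP x). Qed.

Definition sphere_op (x y : sphere) : sphere :=
  exist _ (vec_op (sval x) (sval y)) (vec_op_sphere x y).

Lemma sphere_opP : quandle_axioms sphere_op.
Proof.
split.
- have e1 : dot (delta_mx 0 0 : 'rV[R]_n.+1) (delta_mx 0 0) == 1.
    rewrite /dot (bigD1 ord0) //= big1 => [|i /negbTE i0].
      by rewrite !mxE !eqxx mulr1 addr0.
    by rewrite !mxE i0 andbF mulr0.
  by exists (exist _ (delta_mx 0 0) e1).
- move=> [x x1]; apply: val_inj => /=.
  by rewrite /vec_op (eqP x1) mulr1 scaler_nat mulr2n addrK.
- move=> [y y1]; exists (sphere_op^~ (exist _ y y1)) => -[x x1];
    apply: val_inj => /=; rewrite /vec_op dotBl dotZl (eqP y1) mulr1;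
    by apply/rowP => i; rewrite !mxE; ring.
- move=> [x x1] [y y1] [z z1]; apply: val_inj => /=.
  have -> : vec_op (vec_op x z) (vec_op y z) =
            (2 * dot x y) *: vec_op y z - vec_op x z.
    by rewrite -(dot_vec_op x y (eqP z1)).
  rewrite /vec_op dotBl dotZl.
  by apply/rowP => i; rewrite !mxE; ring.
Qed.

Definition spherical_quandle : quandle := Quandle sphere_opP.

End SphericalQuandle.

(* Z/mZ is 'I_m with its additive group structure, which the library provides
   on 'I_k.+1; we use m.-1.+1, equal to m for m >= 1.  ('Z_m would be wrong
   for m = 1.) *)
Definition dihedral_op (m : nat) (x y : 'I_m.-1.+1) : 'I_m.-1.+1 := y *+ 2 - x.

Lemma dihedral_opP (m : nat) : quandle_axioms (@dihedral_op m).
Proof.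
split; rewrite /dihedral_op.
- by exists 0.
- by move=> x; rewrite mulr2n addrK.
- by move=> y; exists (fun x => y *+ 2 - x) => x; rewrite opprB addrCA subrr addr0.
- move=> x y z; rewrite mulrnBl !opprB [z *+ 2 *+ 2]mulr2n.
  move: (z *+ 2) (y *+ 2) => c b.
  rewrite -!addrA; congr (_ + _); apply/esym.
  by rewrite addrC -!addrA addNr addr0 addrC.
Qed.

Definition dihedral_quandle (m : nat) : quandle := Quandle (dihedral_opP m).

Definition reflection (R : realType) (d : nat) (a v : 'rV[R]_d) : 'rV[R]_d :=
  v - (2 * dot v a / dot a a) *: a.

Record root_system (R : realType) (d : nat) (X : set 'rV[R]_d) : Prop :=
  RootSystem {
  root_finite : finite_set X;
  root_neq0 : ~ X 0;
  root_line : forall a, X a ->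
    [set c *: a | c in [set: R]] `&` X = [set a; - a];
  root_reflection : forall a, X a -> reflection a @` X = X }.

(* Main.v *)
Require Import Defs.
From mathcomp Require Import all_boot all_order all_algebra.
From mathcomp Require Import all_classical all_reals.
From mathcomp Require Import cyclic complex ring lra.
Import Order.TTheory GRing.Theory Num.Theory.

Set Implicit Arguments.
Unset Strict Implicit.
Unset Printing Implicit Defensive.

Local Open Scope classical_set_scope.
Local Open Scope ring_scope.

(** The map [x |-> x |> y] is an involution of X (the half-turn about the line
    of y) whose only possible fixed points are y and -y.  Counting fixed points
    modulo 2 gives the dichotomy [mem_opp]: for every y in X, -y lies in X
    exactly when #X is even.

    If #X is even, then X = -X, and since the reflection in a unit vector a is
    [v |-> - (v |> a)], X is a root system ([opp_closed_root_system]).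

    If #X is odd, then X contains no antipodal pair, hence no orthogonal pair:
    [<a, b> = 0] would give [a |> b = -a].  This forces X into a plane
    ([gram_eq0]), for the same reason that a rank 3 root system must contain two
    orthogonal roots.  Suppose that some triple of X has a nonzero Gram
    determinant G, and let p = <a, b>, q = <b, c>, r = <a, c>.  Replacing b by
    [a |> b] multiplies G by 4 p^2, which is nonzero; so a triple with G
    positive and minimal satisfies p^2, q^2, r^2 >= 1/4.  If pqr <= 0 then
    already G <= 1 - 2/8 - 3/4 = 0, so pqr > 0.  Among the triples with this G
    choose one minimizing p^2 + q^2 + r^2.  The substitutions of [b |> a] for b
    and of [a |> b] for a keep G and p, and change q into 2pr - q, respectively
    r into 2pq - r; minimality yields pqr <= p^2 r^2 and pqr <= p^2 q^2.
    Multiplying these, p^2 >= 1, which is absurd as a and b are independent.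

    In the plane, complex coordinates z with z(a) = 1 for some a in X turn the
    operation into [z(x |> y) = z(y)^2 / z(x)] ([circle_coordinates]).  The set
    Z of these complex numbers contains 1 and is closed under w^2 / v, so
    multiplication by w^2 permutes it; comparing products of all elements,
    w^(2m) = 1 where m = #X.  As w^m is in Z and -1 is not, w^m = 1.  So Z
    consists of all m-th roots of unity, the powers of a primitive root g
    ([core_prim_root]), and the exponent of g identifies X with R_m
    ([dihedral_index]). *)

(** * Permutations and involutions of a duplicate-free sequence *)

Lemma perm_map_stable (T : eqType) (s : seq T) (f : T -> T) :
  uniq s -> {in s &, injective f} -> {in s, forall x, f x \in s} ->
  perm_eq (map f s) s.
Proof.
move=> us injf sf.
have um : uniq (map f s) by rewrite map_inj_in_uniq.
apply: uniq_perm => //.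
have sub : {subset map f s <= s} by move=> _ /mapP[x xs ->]; apply: sf.
by case: (uniq_min_size um sub); rewrite ?size_map.
Qed.

(** The positions in [s] order its elements; the involution exchanges the
    elements it moves forward with those it moves backward, so that there are
    as many of the former as of the latter. *)
Lemma odd_size_fixpoints (T : eqType) (s : seq T) (f : T -> T) :
  uniq s -> {in s, forall x, f x \in s} -> {in s, forall x, f (f x) = x} ->
  odd (size s) = odd (count (fun x => f x == x) s).
Proof.
move=> us sf ff.
have injf : {in s &, injective f}.
  by move=> x y xs ys e; rewrite -(ff x xs) e ff.
pose lt x := (index x s < index (f x) s)%N.
pose gt x := (index (f x) s < index x s)%N.
have ltgt : count lt s = count gt s.
  rewrite -(permP (perm_map_stable us injf sf)) count_map.
  by apply: eq_in_count => x xs; rewrite /= /lt /gt ff.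
have eqE x : x \in s -> (f x == x) = (index x s == index (f x) s).
  move=> xs; apply/eqP/eqP => [-> //|e].
  by rewrite -[RHS](nth_index x xs) e nth_index ?sf.
have -> : size s = (count (fun x => f x == x) s + (count lt s + count gt s))%N.
  rewrite -(count_predC (fun x => f x == x)); congr addn.
  rewrite -count_predUI [count (predI _ _) _](_ : _ = 0%N) ?addn0.
    by apply: eq_in_count => x xs /=; rewrite eqE // /lt /gt neq_ltn.
  rewrite (eq_count (a2 := pred0)) ?count_pred0 // => x /=.
  by rewrite /lt /gt; case: ltngtP.
by rewrite ltgt addnn oddD odd_double addbF.
Qed.

(** * Finite subsets of a field closed under w^2 / v *)

Section CoreOfField.
Variables (F : fieldType) (Z : seq F).
Hypotheses (Z_uniq : uniq Z) (Z1 : 1 \in Z).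
Hypotheses (Z_N1 : -1 \notin Z) (Z_neq0 : 0 \notin Z).
Hypothesis Z_core : {in Z &, forall w v, w ^+ 2 / v \in Z}.

Lemma core_neq0 w : w \in Z -> w != 0.
Proof. by apply: contraTneq => ->. Qed.

Lemma core_exp w k : w \in Z -> w ^+ k \in Z.
Proof.
move=> wZ; suff [] : w ^+ k \in Z /\ w ^+ k.+1 \in Z by [].
elim: k => [|k [IH1 IH2]]; first by rewrite expr0 expr1.
split=> //; have := Z_core IH2 IH1.
rewrite [_ / _](_ : _ = w ^+ k.+2) // !exprS expr0 mulr1; field.
by rewrite expf_neq0 // core_neq0.
Qed.

(** Multiplication by w^2 permutes Z, because [w^2 v = w^2 / (1^2 / v)]. *)
Lemma core_unity_root w : w \in Z -> w ^+ size Z = 1.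
Proof.
move=> wZ.
have sq0 : w ^+ 2 != 0 by rewrite expf_neq0 // core_neq0.
have perm : perm_eq (map ( *%R (w ^+ 2)) Z) Z.
  apply: perm_map_stable => // [x y _ _|v vZ]; first exact: mulfI.
  by have := Z_core wZ (Z_core Z1 vZ); rewrite expr1n div1r invrK.
have prodM (c : F) s :
    \prod_(v <- s) (c * v) = c ^+ size s * \prod_(v <- s) v.
  elim: s => [|x s IH]; first by rewrite !big_nil mulr1.
  by rewrite !big_cons IH /= exprS; ring.
have prod0 : \prod_(v <- Z) v != 0.
  by rewrite prodf_seq_neq0; apply/allP => v vZ /=; exact: core_neq0.
have : \prod_(v <- map ( *%R (w ^+ 2)) Z) v = \prod_(v <- Z) v.
  exact: perm_big.
rewrite big_map prodM => /(canRL (mulfK prod0)); rewrite divff //.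
rewrite exprAC => /eqP; rewrite sqrf_eq1 => /orP[/eqP //|/eqP e].
by have := core_exp (size Z) wZ; rewrite e (negbTE Z_N1).
Qed.

Lemma core_prim_root : exists g : F, (size Z).-primitive_root g.
Proof.
have Z_gt0 : (0 < size Z)%N by move: Z1; case: Z.
have unity : all (size Z).-unity_root Z.
  by apply/allP => w /core_unity_root /eqP; rewrite unity_rootE.
have /hasP[g _ gP] := has_prim_root Z_gt0 unity Z_uniq (leqnn _).
by exists g.
Qed.

End CoreOfField.

(** * Unit vectors and Gram determinants *)

Section Gram.
Variables (R : realType) (d : nat).
Implicit Types a b c u v w x y : 'rV[R]_d.

Lemma dot_ge0 u : 0 <= dot u u.
Proof. by apply: sumr_ge0 => i _; rewrite -expr2 sqr_ge0. Qed.

Lemma dot_eq0 u : dot u u = 0 -> u = 0.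
Proof.
move=> u0; apply/rowP => i; rewrite mxE; apply/eqP.
have ge0 j : true -> 0 <= u 0 j * u 0 j by rewrite -expr2 sqr_ge0.
by have /eqP := psumr_eq0P ge0 u0 isT (i := i); rewrite -expr2 sqrf_eq0.
Qed.

Lemma dotDr u v w : dot u (v + w) = dot u v + dot u w.
Proof. by rewrite dotC dotDl !(dotC u). Qed.

Lemma dotNr u v : dot u (- v) = - dot u v.
Proof. by rewrite dotC dotNl dotC. Qed.

Definition dotE :=
  (@dotDl R d, dotDr, @dotNl R d, dotNr, @dotZl R d, @dotZr R d).

(** The equality case of Cauchy-Schwarz: |x - y|^2 = 2 - 2 <x, y>. *)
Lemma unit_eq x y : dot x x = 1 -> dot y y = 1 -> dot x y = 1 -> x = y.
Proof.
move=> x1 y1 xy; apply/eqP; rewrite -subr_eq0; apply/eqP/dot_eq0.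
by rewrite !dotE (dotC y) x1 y1 xy; ring.
Qed.

Lemma one_sub_sqr_dot_gt0 a b : dot a a = 1 -> dot b b = 1 ->
  b != a -> b != - a -> 0 < 1 - dot a b ^+ 2.
Proof.
move=> a1 b1 ba bNa.
have ge0 : 0 <= 1 - dot a b ^+ 2.
  have := dot_ge0 (b - dot a b *: a).
  by rewrite !dotE (dotC b a) a1 b1; lra.
rewrite lt_neqAle ge0 andbT eq_sym subr_eq0 eq_sym sqrf_eq1.
apply/norP; split.
  by apply: contraNneq ba => e; rewrite eq_sym; apply/eqP/unit_eq.
apply: contraNneq bNa => e; apply/eqP/unit_eq => //; rewrite !dotE ?opprK //.
by rewrite dotC e opprK.
Qed.

(** The Gram determinant of three unit vectors. *)
Definition gram a b c : R :=
  1 + 2 * dot a b * dot b c * dot a c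
    - dot a b ^+ 2 - dot b c ^+ 2 - dot a c ^+ 2.

(** The component of [c] orthogonal to the plane of [a] and [b], scaled by
    [1 - dot a b ^+ 2] to avoid a division. *)
Definition plane_defect a b c : 'rV[R]_d :=
  (1 - dot a b ^+ 2) *: c - (dot a c - dot a b * dot b c) *: a
    - (dot b c - dot a b * dot a c) *: b.

Lemma dot_plane_defect a b c :
  dot a a = 1 -> dot b b = 1 -> dot c c = 1 ->
  dot (plane_defect a b c) (plane_defect a b c)
    = (1 - dot a b ^+ 2) * gram a b c.
Proof.
move=> a1 b1 c1; rewrite /plane_defect /gram !dotE.
by rewrite (dotC b a) (dotC c a) (dotC c b) a1 b1 c1; ring.
Qed.

Lemma gram_dup a c : dot a a = 1 -> gram a a c = 0.
Proof. by move=> a1; rewrite /gram a1; ring. Qed.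

Lemma gram_ge0 a b c :
  dot a a = 1 -> dot b b = 1 -> dot c c = 1 -> 0 <= gram a b c.
Proof.
move=> a1 b1 c1; have [->|ba] := eqVneq b a; first by rewrite gram_dup.
have [->|bNa] := eqVneq b (- a).
  by rewrite /gram !dotE a1 [leRHS](_ : _ = 0) //; ring.
rewrite -(pmulr_rge0 _ (one_sub_sqr_dot_gt0 a1 b1 ba bNa)).
by rewrite -dot_plane_defect // dot_ge0.
Qed.

End Gram.

(** * Finite subquandles of the sphere *)

Section FiniteSubquandle.
Variables (R : realType) (n : nat).
Local Notation V := 'rV[R]_n.+1.
Implicit Types a b c x y : V.

Lemma vec_op_fix x y : dot x x = 1 -> dot y y = 1 ->
  (vec_op x y == x) = (x == y) || (x == - y).
Proof.
move=> x1 y1; apply/eqP/orP => [e|[/eqP->|/eqP->]].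
- have : dot (vec_op x y) x = 1 by rewrite e.
  rewrite /vec_op !dotE x1 (dotC y) => h.
  have /eqP : dot x y ^+ 2 = 1 by lra.
  rewrite sqrf_eq1 => /orP[] /eqP h'; [left|right]; apply/eqP.
    exact: unit_eq.
  by apply: unit_eq; rewrite ?dotE ?opprK // h' opprK.
- by rewrite /vec_op y1 mulr1 scaler_nat mulr2n addrK.
- rewrite /vec_op dotNl y1 opprK mulrN1 scaleNr scaler_nat mulr2n.
  by rewrite opprD addrNK.
Qed.

Lemma vec_opK y : dot y y = 1 -> involutive (fun x => vec_op x y).
Proof.
move=> y1 x; rewrite /vec_op !dotE y1.
by apply/rowP => i; rewrite !mxE; ring.
Qed.

Lemma vec_opN x y : vec_op (- x) y = - vec_op x y.
Proof. by rewrite /vec_op dotNl mulrN scaleNr opprK opprB addrC. Qed.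

Variable s : seq V.
Hypotheses (s_uniq : uniq s) (s_unit : {in s, forall x, dot x x = 1}).
Hypothesis s_closed : {in s &, forall x y, vec_op x y \in s}.

(** The half-turn about y acts on [s] as an involution with fixed points y and,
    if it belongs to [s], -y. *)
Lemma mem_opp y : y \in s -> (- y \in s) = ~~ odd (size s).
Proof.
move=> ys; have y1 := s_unit ys.
have yNy : y != - y.
  apply/eqP => e; have : dot y y = - dot y y by rewrite {1}e dotNl.
  by rewrite y1; lra.
rewrite (@odd_size_fixpoints _ s (fun x => vec_op x y)) //; first last.
- by move=> x _; exact: vec_opK.
- by move=> x xs; apply: s_closed.
rewrite (@eq_in_count _ _ (predU (pred1 y) (pred1 (- y)))) => [|x xs];
  last by rewrite vec_op_fix // s_unit.
have -> : count (predU (pred1 y) (pred1 (- y))) s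
    = (count_mem y s + count_mem (- y) s)%N.
  rewrite -count_predUI [count (predI _ _) s](_ : _ = 0%N) ?addn0 //.
  rewrite (eq_count (a2 := pred0)) ?count_pred0 // => x /=.
  by case: (x =P y) => //= ->; exact: negbTE.
by rewrite !count_uniq_mem // ys; case: (- y \in s).
Qed.

(** * An odd subquandle is planar *)

Hypothesis s_odd : odd (size s).

Lemma opp_notin y : y \in s -> - y \notin s.
Proof. by move=> ys; rewrite mem_opp // s_odd. Qed.

Lemma dot_neq0 a b : a \in s -> b \in s -> dot a b != 0.
Proof.
move=> sa sb; apply/eqP => ab; have := s_closed sa sb.
by rewrite /vec_op ab mulr0 scale0r sub0r (negbTE (opp_notin sa)).
Qed.

Lemma dot_sqr_lt1 a b :
  a \in s -> b \in s -> b != a -> 0 < 1 - dot a b ^+ 2.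
Proof.
move=> sa sb ba; apply: one_sub_sqr_dot_gt0; rewrite ?s_unit //.
by apply: contraTneq sb => ->; exact: opp_notin.
Qed.

(** Replacing one vector x of a pair x, y of the triple by [vec_op y x]
    multiplies the determinant by 4 <x, y>^2, which cannot vanish; at the
    minimum this factor is therefore at least 1. *)
Lemma gram_min_ge_half a b c : a \in s -> b \in s -> c \in s ->
  0 < gram a b c ->
  {in s & & s, forall x y z, 0 < gram x y z -> gram a b c <= gram x y z} ->
  [/\ 1 <= 4 * dot a b ^+ 2, 1 <= 4 * dot b c ^+ 2
    & 1 <= 4 * dot a c ^+ 2].
Proof.
move=> sa sb sc g0 gmin.
have half x y a' b' c' : x \in s -> y \in s ->
    a' \in s -> b' \in s -> c' \in s ->
    gram a' b' c' = 4 * dot x y ^+ 2 * gram a b c -> 1 <= 4 * dot x y ^+ 2.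
  move=> sx sy sa' sb' sc' e; rewrite -(ler_pMl _ g0) -e.
  apply: gmin => //; rewrite e mulr_gt0 // mulr_gt0 //.
  by rewrite exprn_even_gt0 //= dot_neq0.
have [a1 b1] : dot a a = 1 /\ dot b b = 1 by rewrite !s_unit.
have sab := s_closed sa sb; have sbc := s_closed sb sc.
have sac := s_closed sa sc.
split.
- apply: (half a b a (vec_op a b) c) => //; rewrite /gram /vec_op !dotE a1.
  ring.
- apply: (half b c a b (vec_op b c)) => //; rewrite /gram /vec_op !dotE b1.
  by rewrite ?(dotC b a); ring.
- apply: (half a c a b (vec_op a c)) => //; rewrite /gram /vec_op !dotE a1.
  by rewrite ?(dotC b a); ring.
Qed.

Lemma triple_argmin (P : pred (V * V * V)) (f : V * V * V -> R) :
  {in s & & s, forall a b c, P (a, b, c) ->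
    exists a' b' c',
    [/\ [/\ a' \in s, b' \in s & c' \in s], P (a', b', c') &
      {in s & & s, forall x y z,
        P (x, y, z) -> f (a', b', c') <= f (x, y, z)}]}.
Proof.
move=> a b c sa sb sc Pabc.
pose v (t : seq_sub s * seq_sub s * seq_sub s) :=
  (ssval t.1.1, ssval t.1.2, ssval t.2).
pose t0 := (SeqSub sa, SeqSub sb, SeqSub sc).
have [t Pt tmin] :=
  @Order.TotalTheory.arg_minP _ R _ t0 (P \o v) (f \o v) Pabc.
exists (ssval t.1.1), (ssval t.1.2), (ssval t.2).
split; rewrite ?ssvalP // => x y z sx sy sz Pxyz.
exact: (tmin (SeqSub sx, SeqSub sy, SeqSub sz) Pxyz).
Qed.

(** Two successive minimizations over the triples of nonzero determinant: of the
    determinant (which makes all angles between the lines at most 60 degrees),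
    then of p^2 + q^2 + r^2. *)
Lemma gram_eq0 a b c : a \in s -> b \in s -> c \in s -> gram a b c = 0.
Proof.
move=> sa sb sc; apply/eqP; rewrite eq_le gram_ge0 ?s_unit // andbT.
rewrite leNgt; apply/negP => g0.
pose D (t : V * V * V) := gram t.1.1 t.1.2 t.2.
have [a1 [b1 [c1 [[sa1 sb1 sc1] gt1 min1]]]] :=
  @triple_argmin (fun t => 0 < D t) D a b c sa sb sc g0.
pose E (t : V * V * V) :=
  dot t.1.1 t.1.2 ^+ 2 + dot t.1.2 t.2 ^+ 2 + dot t.1.1 t.2 ^+ 2.
have [a2 [b2 [c2 [[sa2 sb2 sc2] /eqP/= eD min2]]]] :=
  @triple_argmin (fun t => D t == D (a1, b1, c1)) E
    a1 b1 c1 sa1 sb1 sc1 (eqxx _).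
move: eD min2 min1 gt1; rewrite /D /E /= => <- min2 min1 gt1.
have [p1 q1 r1] := gram_min_ge_half sa2 sb2 sc2 gt1 min1.
have ba : b2 != a2.
  by apply: contraTneq gt1 => ->; rewrite gram_dup ?ltxx ?s_unit.
have := dot_sqr_lt1 sa2 sb2 ba.
have [a21 b21] : dot a2 a2 = 1 /\ dot b2 b2 = 1 by rewrite !s_unit.
have := min2 _ _ _ sa2 (s_closed sb2 sa2) sc2.
have := min2 _ _ _ (s_closed sa2 sb2) sb2 sc2.
move: gt1 p1 q1 r1; rewrite /gram /vec_op !dotE (dotC b2 a2) a21 b21.
move: (dot a2 b2) (dot b2 c2) (dot a2 c2) => p q r gt1 p1 q1 r1 H1 H2 p_lt1.
have {}H1 : p * q * r <= p ^+ 2 * q ^+ 2.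
  suff: p ^+ 2 + q ^+ 2 + r ^+ 2
      <= p ^+ 2 + q ^+ 2 + (2 * p * q - r) ^+ 2 by nra.
  rewrite [leRHS](_ : _ =
    (2 * p * 1 - p) ^+ 2 + q ^+ 2 + (2 * p * q - r) ^+ 2); last by ring.
  by apply: H1; apply/eqP; ring.
have {}H2 : p * q * r <= p ^+ 2 * r ^+ 2.
  suff: p ^+ 2 + q ^+ 2 + r ^+ 2
      <= p ^+ 2 + (2 * p * r - q) ^+ 2 + r ^+ 2 by nra.
  rewrite [leRHS](_ : _ =
    (2 * p * 1 - p) ^+ 2 + (2 * p * r - q) ^+ 2 + r ^+ 2); last by ring.
  by apply: H2; apply/eqP; ring.
(* (pqr)^2 >= 1/64, whereas a positive determinant requires pqr > -1/8. *)
have pqr_gt0 : 0 < p * q * r.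
  rewrite ltNge; apply/negP => le0.
  have : (p * q * r) ^+ 2 < 64^-1 by nra.
  have : 64^-1 <= p ^+ 2 * q ^+ 2 * r ^+ 2.
    have : 16^-1 <= p ^+ 2 * q ^+ 2 by nra.
    by nra.
  by rewrite !exprMn; lra.
have : (p * q * r) * (p * q * r) <= (p ^+ 2 * q ^+ 2) * (p ^+ 2 * r ^+ 2).
  by apply: ler_pM => //; apply: ltW.
have -> : p ^+ 2 * q ^+ 2 * (p ^+ 2 * r ^+ 2)
    = p ^+ 2 * ((p * q * r) * (p * q * r)) by ring.
rewrite leNgt (gtr_pMl _ (mulr_gt0 pqr_gt0 pqr_gt0)) => /negP; apply.
by lra.
Qed.

(** The vector e completes a to an orthonormal basis of the plane of [s].  When
    [s] is reduced to a there is no such plane, and e = 0 serves as well; this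
    is why the conclusion is stated on inner products only. *)
Lemma planar_frame a : a \in s -> exists e : V,
  {in s &, forall x y, dot x y = dot a x * dot a y + dot e x * dot e y}.
Proof.
move=> sa.
have [/hasP[b sb /= ba]|/hasPn all_a] := boolP (has (fun x => x != a) s);
  last first.
  exists 0 => x y /all_a /negPn/eqP -> /all_a /negPn/eqP ->.
  by rewrite -(scale0r a) !dotZl !mul0r addr0 s_unit // mulr1.
have p_lt1 := dot_sqr_lt1 sa sb ba.
(* Gram-Schmidt applied to a, b. *)
exists ((Num.sqrt (1 - dot a b ^+ 2))^-1 *: (b - dot a b *: a)) => x y sx sy.
have : plane_defect a b x = 0.
  apply: dot_eq0; rewrite dot_plane_defect ?gram_eq0 ?mulr0 //; exact: s_unit.
move/(congr1 (fun w => dot w y)).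
rewrite /plane_defect -(scale0r a) !dotE mul0r.
move: (dot a x) (dot b x) (dot a y) (dot b y) (dot x y).
move=> ax bx ay b_y xy h.
have p0 : 1 - dot a b ^+ 2 != 0 by rewrite gt_eqF.
rewrite mulrACA -expr2 exprVn sqr_sqrtr ?ltW //.
by apply: (mulfI p0); rewrite mulrDr (mulVKf p0); lra.
Qed.

(** * An odd subquandle is dihedral *)

(** In the plane of [s], the half-turn about y restricts to the reflection in the
    line of y, which sends the angle of x to twice the angle of y minus the angle
    of x. *)
Lemma circle_coordinates a : a \in s -> exists z : V -> R[i],
  [/\ z a = 1, {in s &, injective z}, {in s, forall x, z x != 0}
    & {in s &, forall x y, z (vec_op x y) = z y ^+ 2 / z x}].
Proof.
move=> sa; have [e frame] := planar_frame sa.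
pose z x : R[i] := Complex (dot a x) (dot e x).
have norm1 x : x \in s -> dot e x ^+ 2 = 1 - dot a x ^+ 2.
  move=> sx; rewrite -(s_unit sx) (frame x x sx sx).
  by rewrite -!expr2 addrAC subrr add0r.
have z_neq0 : {in s, forall x, z x != 0}.
  move=> x sx; apply/eqP => -[ax ex]; have := norm1 x sx.
  by rewrite ax ex !expr0n /= subr0 => /eqP; rewrite eq_sym oner_eq0.
exists z; split=> //.
- (* <a, a> = 1 already exhausts the norm of z(a), so <e, a> = 0. *)
  have := norm1 a sa; rewrite s_unit // expr1n subrr => /eqP.
  by rewrite sqrf_eq0 /z => /eqP ->; rewrite s_unit.
- move=> x y sx sy [ax ex]; apply: unit_eq; rewrite ?s_unit //.
  by rewrite frame // ax ex -frame // s_unit.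
move=> x y sx sy; apply: (canRL (mulfK (z_neq0 x sx))).
rewrite /z /vec_op !dotE (frame x y sx sy).
have := norm1 x sx; have := norm1 y sy.
move: (dot a x) (dot a y) (dot e x) (dot e y) => ax ay ex ey hy hx.
rewrite expr2; apply/eqP; rewrite eq_complex /=; apply/andP; split; apply/eqP.
  rewrite [LHS](_ : _ =
    2 * (ax ^+ 2 * ay ^+ 2 - ex ^+ 2 * ey ^+ 2) - ax ^+ 2 + ex ^+ 2);
    last by ring.
  by rewrite -!expr2 hx hy; ring.
rewrite [LHS](_ : _ =
  2 * (ax * ex) * (ay ^+ 2 + ey ^+ 2) + 2 * (ay * ey) * (ax ^+ 2 + ex ^+ 2)
    - 2 * (ax * ex)); last by ring.
by rewrite hx hy; ring.
Qed.

Lemma dihedral_index : exists k : V -> 'I_(size s).-1.+1,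
  [/\ {in s &, injective k}, forall i, exists2 x, x \in s & k x = i &
    {in s &, forall x y, k (vec_op x y) = @dihedral_op (size s) (k x) (k y)}].
Proof.
have sK : (size s).-1.+1 = size s by move: s_odd; case: size.
have [a sa] : exists a, a \in s.
  by move: s_odd; case: s => // a s' _; exists a; rewrite mem_head.
have [z [za z_inj z_neq0 z_op]] := circle_coordinates sa.
pose Z := map z s.
have sizeZ : size Z = size s by rewrite size_map.
have Z_uniq : uniq Z by rewrite map_inj_in_uniq.
have Z1 : 1 \in Z by rewrite -za map_f.
have Z_core : {in Z &, forall w v, w ^+ 2 / v \in Z}.
  move=> _ _ /mapP[y sy ->] /mapP[x sx ->].
  by rewrite -z_op // map_f // s_closed.
have Z_neq0 : 0 \notin Z.
  by apply/negP => /mapP[x /z_neq0 zx /esym/eqP]; rewrite (negbTE zx).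
(* If z(x) = -1 then x |> a, of coordinate 1 / z(x), is x itself; the fixed
   points of the half-turn about a being a and -a, x is one of them. *)
have Z_N1 : -1 \notin Z.
  apply/negP => /mapP[x sx zx].
  have /eqP : vec_op x a = x.
    apply: z_inj => //; first exact: s_closed.
    by rewrite z_op // za -zx expr1n invrN invr1 mulrN1.
  rewrite vec_op_fix ?s_unit // => /orP[] /eqP e.
    move: zx; rewrite e za => /eqP.
    by rewrite eq_sym -addr_eq0 -mulr2n pnatr_eq0.
  by have := opp_notin sa; rewrite -e sx.
have [g] := core_prim_root Z_uniq Z1 Z_N1 Z_neq0 Z_core.
rewrite sizeZ -sK => gP.
have ex_k x : x \in s -> exists i : 'I_(size s).-1.+1, z x == g ^+ i.
  move=> sx.
  have := core_unity_root Z_uniq Z1 Z_N1 Z_neq0 Z_core (map_f z sx).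
  by rewrite sizeZ -sK => /(prim_rootP gP)[i ->]; exists i.
(* The default value is reached only outside of s. *)
pose k x : 'I_(size s).-1.+1 :=
  odflt ord0 [pick i : 'I_(size s).-1.+1 | z x == g ^+ i].
have zk x : x \in s -> z x = g ^+ k x.
  move=> /ex_k[i zi]; rewrite /k; case: pickP => [j /eqP //|/(_ i)].
  by rewrite zi.
have g_inj (i j : 'I_(size s).-1.+1) : g ^+ i = g ^+ j -> i = j.
  move/eqP; rewrite (eq_prim_root_expr gP) !modn_small // => /eqP.
  exact: val_inj.
have k_inj : {in s &, injective k}.
  by move=> x y sx sy e_k; apply: z_inj => //; rewrite !zk // e_k.
have gD (i j : 'I_(size s).-1.+1) : g ^+ (i + j)%R = g ^+ i * g ^+ j.
  by rewrite -exprD -(prim_expr_mod gP (i + j)%N).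
exists k; split=> // [i|x y sx sy].
  have sub : {subset map k s <= enum 'I_(size s).-1.+1}.
    by move=> j _; rewrite mem_enum.
  have uk : uniq (map k s) by rewrite map_inj_in_uniq.
  have [|_ /(_ i)] := uniq_min_size uk sub.
    by rewrite -cardE card_ord size_map sK.
  by rewrite mem_enum => /mapP[x sx ->]; exists x.
apply: g_inj; apply: (mulIf (z_neq0 x sx)).
rewrite -zk ?s_closed // z_op // divfK ?z_neq0 // [z x]zk // -gD.
by rewrite /dihedral_op subrK mulr2n gD -zk.
Qed.

End FiniteSubquandle.

(** * Root systems and the classification *)

Lemma opp_closed_root_system (R : realType) (n : nat)
    (A : set 'rV[R]_n.+1) :
  finite_set A -> (forall x, A x -> dot x x = 1) ->
  (forall x y, A x -> A y -> A (vec_op x y)) -> (forall x, A x -> A (- x)) ->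
  root_system A.
Proof.
move=> Afin A1 Aop Aopp.
have reflE a v : A a -> reflection a v = - vec_op v a.
  by move=> Aa; rewrite /reflection /vec_op A1 // divr1 opprB.
split => //.
- by move=> /A1 /eqP; rewrite -(scale0r 0) dotZl mul0r eq_sym oner_eq0.
- move=> a Aa; apply/seteqP; split => [_ [[c _ <-]] /A1 /eqP|x /= [->|->]].
  + rewrite !dotE A1 // mulr1 -expr2 sqrf_eq1 /= => /orP[] /eqP ->.
      by left; rewrite scale1r.
    by right; rewrite scaleN1r.
  + by split=> //; exists 1 => //; rewrite scale1r.
  + by split; [exists (-1) => //; rewrite scaleN1r | exact: Aopp].
- move=> a Aa; apply/seteqP; split => [_ [v Av <-]|v Av].
    by rewrite reflE //; apply/Aopp/Aop.
  exists (- vec_op v a); first exact/Aopp/Aop.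
  by rewrite reflE // vec_opN opprK vec_opK // A1.
Qed.

Lemma finite_card_seq (T : choiceType) (A : set T) (m : nat) :
  (A #= `I_m)%card ->
  exists s : seq T, [/\ uniq s, size s = m & A = [set` s]].
Proof.
move=> Am; exists (finmap.enum_fset (fset_set A)).
split; [exact: finmap.fset_uniq|exact: card_fset_set|].
by rewrite fset_setK //; exists m.
Qed.

Theorem theorem1p1 (R : realType) (n : nat)
    (X : subquandle (spherical_quandle R n)) (hfin : finite_set X) :
  forall m : nat, (X #= `I_m)%card ->
    (~~ odd m -> root_system [set sval x | x in (X : set (sphere R n))]) /\
    (odd m -> quandle_isomorphic (quandle_of_sub X) (dihedral_quandle m)).
Proof.
move=> m Xm; have [s [s_uniq s_size sX]] : exists s : seq 'rV[R]_n.+1,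
    [/\ uniq s, size s = m &
      [set sval x | x in (X : set (sphere R n))] = [set` s]].
  apply: finite_card_seq; apply: card_eq_trans Xm.
  by apply: inj_card_eq => x y _ _; exact: val_inj.
have sval_in (x : sphere R n) : (X : set (sphere R n)) x -> sval x \in s.
  by move=> Xx; change ([set` s] (sval x)); rewrite -sX; exists x.
have s_lift v : v \in s ->
    exists2 x : sphere R n, (X : set (sphere R n)) x & sval x = v.
  by move=> vs; have : [set` s] v by []; rewrite -sX => -[x Xx <-]; exists x.
have s_unit : {in s, forall x, dot x x = 1}.
  by move=> _ /s_lift[x _ <-]; exact/eqP/(svalP x).
have s_closed : {in s &, forall x y, vec_op x y \in s}.
  move=> _ _ /s_lift[x Xx <-] /s_lift[y Xy <-].
  apply: (sval_in (sphere_op x y)); apply: set_mem.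
  by apply: (subquandle_closed (s := X)); exact: mem_set.
split=> m_odd.
  apply: opp_closed_root_system.
  - exact: finite_image.
  - by move=> _ [x /sval_in xs <-]; exact: s_unit.
  - move=> _ _ [x Xx <-] [y Yy <-]; apply: s_lift.
    by apply: s_closed; exact: sval_in.
  - move=> _ [x Xx <-]; apply: s_lift.
    by rewrite mem_opp ?s_size // sval_in.
rewrite -s_size in m_odd *.
have [k [k_inj k_surj k_op]] := dihedral_index s_uniq s_unit s_closed m_odd.
pose f (t : quandle_of_sub X) : dihedral_quandle (size s) := k (sval (sval t)).
have in_s (t : quandle_of_sub X) : sval (sval t) \in s.
  by apply: sval_in; apply: set_mem; exact: (svalP t).
exists f; split=> [x y|]; first exact: k_op.
have f_inj : injective f.
  move=> x y /k_inj e; apply: val_inj; apply: val_inj; exact: e.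
have f_surj (i : dihedral_quandle (size s)) : exists t, f t = i.
  have [v /s_lift[x Xx <-] kv] := k_surj i.
  by exists (exist _ x (mem_set Xx)).
have [h hK] := choice f_surj.
by exists h => // t; apply: f_inj.
Qed.
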